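(* Let $K$ be a field with $\operatorname{char}K\neq2$, and let $P,Q\in K[X,Y]$ be relatively prime homogeneous polynomials of degree $2$, with homogeneous differential $D=D_{P,Q}=c(\theta_1X-\eta_1Y)(\theta_2X-\eta_2Y)$ where $c\in K^\times$ and $[\eta_i:\theta_i]\in\mathbb{P}^1(\overline K)$. Let $F=(P,Q)$, let $s_0,t_0\in K$ not both zero, and for $n\ge0$ let $H_n:=t_0P_n-s_0Q_n$ where $(P_n,Q_n)=F^n$. Suppose there is an integer $\ell\geq1$ such that $F^\ell([\eta_1:\theta_1])=F^\ell([\eta_2:\theta_2])$ as points of $\mathbb{P}^1(\overline K)$ but $F^{\ell-1}([\eta_1:\theta_1])\neq F^{\ell-1}([\eta_2:\theta_2])$. Then $\ell\geq2$, and \[\operatorname{Res}(P,Q)\prod_{i=1}^2H_\ell(\eta_i,\theta_i)\in K^2\quad\text{and}\quad\prod_{i=1}^2H_n(\eta_i,\theta_i)\in K^2\ \text{ for every } n\geq\ell+1,\] where $K^2$ denotes the set of squares of elements of $K$.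
   Context: $F^n$ denotes $n$-fold composition of $(X,Y)\mapsto(P,Q)$, with $F^0=(X,Y)$; it also acts on $\mathbb{P}^1(\overline K)$. For homogeneous $P=\prod_{i}(b_iX-a_iY)$, $Q=\prod_j(d_jX-c_jY)$ over $\overline K$ (pairs not both zero), $\operatorname{Res}(P,Q)=\prod_{i,j}(a_id_j-b_ic_j)$. The homogeneous differential is $D_{P,Q}=\frac1Y(P_XQ-PQ_X)$, with formal partial derivatives. *)

(* Defs.v *)
From HB Require Import structures.
From mathcomp Require Import all_boot all_order all_algebra.
From mathcomp Require Import mpoly ring.

Set Implicit Arguments.
Unset Strict Implicit.
Unset Printing Implicit Defensive.

Import GRing.Theory.
Local Open Scope ring_scope.

(* Bivariate polynomials R[X,Y] are {mpoly R[2]}, variable 0 being X and      *)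
(* variable 1 being Y.                                                        *)
Definition varX {R : nzRingType} : {mpoly R[2]} := 'X_ord0.
Definition varY {R : nzRingType} : {mpoly R[2]} := 'X_ord_max.

Definition eval2 (R : comNzRingType) (p : {mpoly R[2]}) (v : R * R) : R :=
  p.@[fun i : 'I_2 => if i == ord0 then v.1 else v.2].

Definition relprime (R : idomainType) (p q : {mpoly R[2]}) : Prop :=
  forall d u v : {mpoly R[2]}, p = u * d -> q = v * d -> d \is a GRing.unit.

(* (divY p) is the quotient of p by Y, dropping the monomials of p that do    *)
(* not involve Y; it satisfies Y * divY p = p as soon as Y divides p (divYK). *)
Definition divY (R : nzRingType) (p : {mpoly R[2]}) : {mpoly R[2]} :=
  \sum_(m <- msupp p | (0 < m ord_max)%N) p@_m *: 'X_[m - U_(ord_max)].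

(* Y does divide the polynomial below when p and q are homogeneous of the     *)
(* same degree, so the division is then exact (homdiffE).                     *)
Definition homdiff (R : comNzRingType) (p q : {mpoly R[2]}) : {mpoly R[2]} :=
  divY (p^`M(ord0) * q - p * q^`M(ord0)).

(* The pair (P_n, Q_n) = F^n for F = (P, Q), with F^0 = (X, Y).               *)
Definition Fiter (R : comNzRingType) (P Q : {mpoly R[2]}) (n : nat) :
    {mpoly R[2]} * {mpoly R[2]} :=
  iter n (fun G => (P \mPo [tuple G.1; G.2], Q \mPo [tuple G.1; G.2]))
    (varX, varY).

(* b X - a Y, the linear form vanishing at [a : b].                           *)
Definition linform (R : comNzRingType) (v : R * R) : {mpoly R[2]} :=
  v.2 *: varX - v.1 *: varY.

(* r is the resultant of p and q: for some factorization into linear forms    *)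
(* p = prod_i (b_i X - a_i Y), q = prod_j (d_j X - c_j Y), with ab i =        *)
(* (a_i, b_i) and cd j = (c_j, d_j), r = prod_(i,j) (a_i d_j - b_i c_j).      *)
(* The value of r does not depend on the factorization; see                   *)
(* is_resultant_exists for its existence.                                     *)
Definition is_resultant (R : fieldType) (p q : {mpoly R[2]}) (r : R) :
    Prop :=
  exists (m n : nat) (ab : 'I_m -> R * R) (cd : 'I_n -> R * R),
    [/\ forall i, ab i != (0, 0),
        forall j, cd j != (0, 0),
        p = \prod_(i < m) linform (ab i),
        q = \prod_(j < n) linform (cd j)
      & r = \prod_(i < m) \prod_(j < n)
              ((ab i).1 * (cd j).2 - (ab i).2 * (cd j).1)].

(* Equality in P^1 of the points with homogeneous coordinates u and v.        *)
Definition proj_eq (R : fieldType) (u v : R * R) : Prop :=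
  exists k : R, k != 0 /\ v = (k * u.1, k * u.2).

(* The action on homogeneous coordinates over L of the n-th iterate of        *)
(* F = (P, Q), where P and Q have coefficients in K and iota : K -> L.        *)
Definition Fpoint (K L : fieldType) (iota : {rmorphism K -> L})
    (P Q : {mpoly K[2]}) (n : nat) (v : L * L) : L * L :=
  (eval2 (map_mpoly iota (Fiter P Q n).1) v,
   eval2 (map_mpoly iota (Fiter P Q n).2) v).

Definition Hpoly (K : fieldType) (P Q : {mpoly K[2]}) (s0 t0 : K) (n : nat) :
    {mpoly K[2]} :=
  t0 *: (Fiter P Q n).1 - s0 *: (Fiter P Q n).2.

(* The image under iota : K -> L of the set K^2 of squares of K.              *)
Definition in_squares (K L : fieldType) (iota : {rmorphism K -> L}) (x : L) :
    Prop :=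
  exists z : K, x = iota (z ^+ 2).

(* L is an algebraic closure of K, via iota : K -> L.                         *)
Definition algebraic_closure_of (K : fieldType) (L : closedFieldType)
    (iota : {rmorphism K -> L}) : Prop :=
  forall x : L, algebraicOver iota x.

Lemma divYE (R : comNzRingType) (p : {mpoly R[2]}) :
  p = \sum_(m <- msupp p | (m ord_max == 0)%N) p@_m *: 'X_[m] + varY * divY p.
Proof.
rewrite {1}[p]mpolyE (bigID (fun m : 'X_{1..2} => m ord_max == 0%N)) /=.
congr (_ + _); rewrite /divY mulr_sumr.
apply: eq_big => [m|m m0]; first by rewrite lt0n.
by rewrite -scalerAr /varY -mpolyXD addmC submK // lep1mP.
Qed.

Lemma divYK (R : comNzRingType) (p : {mpoly R[2]}) :
  varY * divY (varY * p) = varY * p.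
Proof.
rewrite [RHS]divYE big1_seq ?add0r // => m /andP[/eqP m0].
rewrite mulrC (perm_mem (msuppMX _ _)) => /mapP[m' _ mE].
by move: m0; rewrite mE mnmDE mnm1E eqxx.
Qed.

Lemma dhomog_divYE (R : comNzRingType) (d : nat) (p : {mpoly R[2]}) :
  p \is d.-homog ->
  p = p@_(U_(ord0) *+ d) *: varX ^+ d + varY * divY p.
Proof.
move=> /dhomogP hp; rewrite {1}[p]divYE; congr (_ + _).
have e m : m \in msupp p -> m ord_max = 0%N -> m = (U_(ord0) *+ d)%MM.
  move=> ms; have /= := hp m ms; rewrite mdegE big_ord_recl big_ord1.
  rewrite (_ : lift _ _ = ord_max); last exact/val_inj.
  move=> + m0; rewrite m0 addn0 => md; apply/mnmP => i; rewrite mulmnE mnm1E.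
  case: (unliftP ord_max i) => [j ->|->]; last by rewrite m0.
  rewrite (_ : lift _ _ = ord0) ?eqxx ?mul1n //.
  by apply/val_inj; case: j => [[]].
rewrite /varX mpolyXn big_seq_cond.
rewrite (eq_big (fun m => (m \in msupp p) && (m == (U_(ord0) *+ d)%MM))
  (fun _ => p@_(U_(ord0) *+ d) *: 'X_[U_(ord0) *+ d])); last first.
- by move=> m /andP[ms /eqP m0]; rewrite -(e m).
- move=> m; case ms : (m \in msupp p) => //=; apply/eqP/eqP; first exact: e.
  by move=> ->; rewrite mulmnE mnm1E.
rewrite -big_seq_cond; have [s|s] := boolP ((U_(ord0) *+ d)%MM \in msupp p).
  by rewrite -big_filter filter_pred1_uniq // ?big_seq1 // msupp_uniq.
rewrite big1_seq => [|m /andP[/eqP -> /(negP s)] //].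
by move: s; rewrite -mcoeff_eq0 => /eqP ->; rewrite scale0r.
Qed.

Lemma homdiffE (R : comNzRingType) (d : nat) (p q : {mpoly R[2]}) :
  p \is d.-homog -> q \is d.-homog ->
  varY * homdiff p q = p^`M(ord0) * q - p * q^`M(ord0).
Proof.
move=> /dhomog_divYE hp /dhomog_divYE hq; rewrite /homdiff.
suff [s ->] : exists s, p^`M(ord0) * q - p * q^`M(ord0) = varY * s.
  exact: divYK.
rewrite hp hq; move: (p@_ _) (q@_ _) (divY p) (divY q) => a b u v.
have dY : (varY : {mpoly R[2]})^`M(ord0) = 0.
  by rewrite /varY mderivX mnm1E scale0r.
rewrite !mderivD !mderivM !mderivZ dY; set e := (varX ^+ d)^`M(ord0).
rewrite -!mul_mpolyC; set x := varX ^+ d; set u' := u^`M(_); set v' := v^`M(_).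
exists (a%:MP * e * v + u' * (b%:MP * x + varY * v)
  - a%:MP * x * v' - u * (b%:MP * e + varY * v')).
ring.
Qed.

Lemma dhomog_divY (R : comNzRingType) (d : nat) (p : {mpoly R[2]}) :
  p \is d.+1.-homog -> divY p \is d.-homog.
Proof.
move=> /dhomogP hp; rewrite /divY big_seq_cond; apply: rpred_sum => m.
move=> /andP[ms m0]; apply: dhomogZ; rewrite dhomogX /=.
have /= := hp m ms; rewrite -{1}(@submK _ U_(ord_max) m) ?lep1mP -?lt0n //.
by rewrite mdegD mdeg1 addn1 => -[->].
Qed.

Lemma linform_factorization (L : closedFieldType) (p : {mpoly L[2]}) :
  p \is 2.-homog -> p != 0 ->
  exists ab : 'I_2 -> L * L,
    (forall i, ab i != (0, 0)) /\ p = \prod_(i < 2) linform (ab i).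
Proof.
move=> h2 p0; have h1 := dhomog_divY h2; have h0 := dhomog_divY h1.
have := dhomog_divYE h2; rewrite (dhomog_divYE h1).
have -> : divY (divY p) = ((divY (divY p))@_0)%:MP.
  apply/mpolyP => m; rewrite mcoeffC; case: eqP => [<-|m0]; first by rewrite mulr1.
  rewrite mulr0; apply/eqP; rewrite mcoeff_eq0; apply/negP => ms.
  have /= /eqP := dhomog_mf h0 ms.
  by rewrite mdeg_eq0 => /eqP m0'; apply: m0; rewrite m0'.
move: (p@_ _) ((divY p)@_ _) (_@_0%MM) => a b c pE.
have wrap (u v : L * L) : p = linform u * linform v ->
    exists ab : 'I_2 -> L * L,
    (forall i, ab i != (0, 0)) /\ p = \prod_(i < 2) linform (ab i).
  move=> uv; exists (fun i => if i == ord0 then u else v); split; last first.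
    by rewrite big_ord_recl big_ord1.
  have lf0 : linform ((0, 0) : L * L) = 0.
    by rewrite /linform /= !scale0r subr0.
  move=> i; case: ifP => _; apply/negP => /eqP e; move: p0;
    by rewrite uv e lf0 ?mul0r ?mulr0 eqxx.
rewrite -!mul_mpolyC in pE.
have [a0|a0] := eqVneq a 0.
  apply: (wrap (-1, 0) (-c, b)); rewrite pE a0 /linform /= -!mul_mpolyC.
  rewrite !mpolyCN !mpolyC0 mpolyC1; ring.
have [r hr] := @solve_monicpoly L 2
  (fun i => if i == 0%N then - c / a else - b / a) isT.
rewrite big_ord_recl big_ord1 /= expr0 expr1 mulr1 in hr.
apply: (wrap (a * r, a) (- b / a - r, 1)).
rewrite pE /linform /= -!mul_mpolyC.
have bE : b = - a * ((- b / a - r) + r) by field.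
have cE : c = a * r * (- b / a - r).
  have -> : c = - a * (r ^+ 2 + b / a * r) by rewrite hr; field.
  by field.
move: (- b / a - r) bE cE => s -> ->.
rewrite !(mpolyCN, mpolyCM, mpolyCD) mpolyC1; ring.
Qed.

Lemma is_resultant_exists (K : fieldType) (L : closedFieldType)
    (iota : {rmorphism K -> L}) (P Q : {mpoly K[2]}) :
  P \is 2.-homog -> Q \is 2.-homog -> relprime P Q ->
  exists r : L, is_resultant (map_mpoly iota P) (map_mpoly iota Q) r.
Proof.
have nu (p : {mpoly K[2]}) : p \is 2.-homog -> p \is a GRing.unit -> False.
  move=> /dhomogP hp; rewrite unfold_in => /andP[/eqP pE].
  rewrite unitfE mcoeff_eq0 negbK => /hp /=; by rewrite mdeg0.
have mh (p : {mpoly K[2]}) : p \is 2.-homog -> map_mpoly iota p \is 2.-homog.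
  move=> /dhomogP hp; apply/dhomogP => m; rewrite mcoeff_msupp mcoeff_map_mpoly.
  by rewrite fmorph_eq0 -mcoeff_msupp => /hp.
have mi (p : {mpoly K[2]}) : map_mpoly iota p = 0 -> p = 0.
  move=> h; apply/mpolyP => m; apply: (fmorph_inj iota).
  by rewrite -mcoeff_map_mpoly h !mcoeff0 rmorph0.
move=> hP hQ co.
have P0 : map_mpoly iota P != 0.
  apply/eqP => /mi P0; apply: (nu Q) => //; apply: (co Q 0 1).
    by rewrite P0 mul0r.
  by rewrite mul1r.
have Q0 : map_mpoly iota Q != 0.
  apply/eqP => /mi Q0; apply: (nu P) => //; apply: (co P 1 0).
    by rewrite mul1r.
  by rewrite Q0 mul0r.
have [ab [ab0 PE]] := linform_factorization (mh _ hP) P0.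
have [cd [cd0 QE]] := linform_factorization (mh _ hQ) Q0.
by eexists; exists 2%N, 2%N, ab, cd; split; last reflexivity.
Qed.

(* Main.v *)
(* Write P = p0 X^2 + p1 XY + p2 Y^2, Q likewise, and let A, B, C be the 2x2
   minors of the coefficient matrix, so that D = A X^2 + 2B XY + C Y^2 and
   Res(P,Q) = B^2 - AC.  For any two vectors x and y,
     F(x) ^ F(y) = (x ^ y) D(x, y),
   where D(x, y) is the polar form of D.  Put x = F^(n-1)(v1), y = F^(n-1)(v2)
   with v1, v2 the critical points: the coefficients x1 y1, x1 y2 + x2 y1,
   x2 y2 lie in K, by induction on n, since they do for v1, v2.  Let
   G = t0 P - s0 Q, so that H_n(v1) H_n(v2) = G(x) G(y).
   - If n = l then x ^ y <> 0 and F(x) ^ F(y) = 0, so D(x, y) = 0, and then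
     Res(P,Q) G(x) G(y) = T(x, y)^2 with T the polar form of a quarter of the
     Jacobian of (G, D).
   - If n > l then x ^ y = 0, and G(x) G(y) = G(x, y)^2.
   If l = 1, D(x, y) is a nonzero multiple of (v1 ^ v2)^2,
   which is nonzero. *)
Require Import Defs.
From HB Require Import structures.
From mathcomp Require Import all_boot all_order all_algebra.
From mathcomp Require Import mpoly.
From mathcomp Require Import ring.

Set Implicit Arguments.
Unset Strict Implicit.
Unset Printing Implicit Defensive.

Import GRing.Theory.
Local Open Scope ring_scope.

(** * Binary quadratic forms and their coefficients *)

Definition quadform (R : comNzRingType) (a b c : R) : {mpoly R[2]} :=
  a *: varX ^+ 2 + b *: (varX * varY) + c *: varY ^+ 2.

Definition qval (R : comNzRingType) (a b c : R) (v : R * R) : R :=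
  a * v.1 ^+ 2 + b * (v.1 * v.2) + c * v.2 ^+ 2.

Definition wedge (R : comNzRingType) (x y : R * R) : R := x.1 * y.2 - x.2 * y.1.

Lemma dhomog2_quadform (R : comNzRingType) (p : {mpoly R[2]}) :
  p \is 2.-homog -> exists a b c : R, p = quadform a b c.
Proof.
move=> h2; have h1 := dhomog_divY h2; have h0 := dhomog_divY h1.
have := dhomog_divYE h2; rewrite (dhomog_divYE h1).
have -> : divY (divY p) = ((divY (divY p))@_0)%:MP.
  apply/mpolyP => m; rewrite mcoeffC; case: eqP => [<-|m0]; first by rewrite mulr1.
  rewrite mulr0; apply/eqP; rewrite mcoeff_eq0; apply/negP => ms.
  have /= /eqP := dhomog_mf h0 ms.
  by rewrite mdeg_eq0 => /eqP m0'; apply: m0; rewrite m0'.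
move: (p@_ _) ((divY p)@_ _) (_@_0%MM) => a b c pE.
by exists a, b, c; rewrite pE /quadform -!mul_mpolyC; ring.
Qed.

Section Eval2.
Variable R : comNzRingType.
Implicit Types (p q : {mpoly R[2]}) (v : R * R).

Lemma eval2D p q v : eval2 (p + q) v = eval2 p v + eval2 q v.
Proof. exact: mevalD. Qed.
Lemma eval2B p q v : eval2 (p - q) v = eval2 p v - eval2 q v.
Proof. exact: mevalB. Qed.
Lemma eval2M p q v : eval2 (p * q) v = eval2 p v * eval2 q v.
Proof. exact: mevalM. Qed.
Lemma eval2Z a p v : eval2 (a *: p) v = a * eval2 p v.
Proof. exact: mevalZ. Qed.
Lemma eval2_varX v : eval2 varX v = v.1.
Proof. by rewrite /eval2 mevalXU. Qed.
Lemma eval2_varY v : eval2 varY v = v.2.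
Proof. by rewrite /eval2 mevalXU. Qed.

Definition eval2E :=
  (eval2B, eval2D, eval2M, eval2Z, eval2_varX, eval2_varY).

Lemma eval2_quadform a b c v : eval2 (quadform a b c) v = qval a b c v.
Proof. by rewrite /quadform !expr2 !eval2E /qval !expr2. Qed.

(** The points (1,0), (0,1) and (1,1) already determine the coefficients, so the argument works over
    any ring, however small. *)
Lemma qval_inj (a b c a' b' c' : R) :
  qval a b c =1 qval a' b' c' -> [/\ a = a', b = b' & c = c'].
Proof.
move=> e; have := e (1, 1); have := e (0, 1); have := e (1, 0).
rewrite /qval /= !expr1n !expr0n /= !(mulr0, mulr1, addr0, add0r) => -> ->.
by move=> /addIr/addrI ->.
Qed.

Lemma quadform_eq0 (a b c : R) : quadform a b c = 0 -> [/\ a = 0, b = 0 & c = 0].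
Proof.
move=> e; apply: qval_inj => v.
by rewrite -eval2_quadform e /eval2 meval0 /qval !mul0r !addr0.
Qed.

Lemma eval2_linform u v : eval2 (linform u) v = u.2 * v.1 - u.1 * v.2.
Proof. by rewrite /linform !eval2E. Qed.

Lemma quadform_linform2 (a b c : R) u v :
  quadform a b c = linform u * linform v ->
  [/\ a = u.2 * v.2, b = - (u.1 * v.2 + u.2 * v.1) & c = u.1 * v.1].
Proof.
move=> e; apply: qval_inj => z.
by rewrite -eval2_quadform e eval2M !eval2_linform /qval; ring.
Qed.

End Eval2.

(** * Composition, base change and differential of quadratic forms *)

Lemma comp_quadform (R : comNzRingType) (a b c : R) (p q : {mpoly R[2]}) :
  quadform a b c \mPo [tuple p; q] =
  a *: p ^+ 2 + b *: (p * q) + c *: q ^+ 2.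
Proof.
by rewrite /quadform !comp_mpolyD !comp_mpolyZ !rmorphXn rmorphM /=
  !comp_mpolyXU.
Qed.

Lemma map_varX (R S : nzRingType) (f : {rmorphism R -> S}) :
  map_mpoly f varX = varX.
Proof. exact: map_mpolyX. Qed.

Lemma map_varY (R S : nzRingType) (f : {rmorphism R -> S}) :
  map_mpoly f varY = varY.
Proof. exact: map_mpolyX. Qed.

Lemma map_quadform (R S : comNzRingType) (f : {rmorphism R -> S}) (a b c : R) :
  map_mpoly f (quadform a b c) = quadform (f a) (f b) (f c).
Proof.
by rewrite /quadform !rmorphD /= !map_mpolyZ !rmorphXn rmorphM /=
  map_varX map_varY.
Qed.

(** Checked after multiplication by Y, which is cancellable, so the quotient [divY] is never
    expanded. *)
Lemma homdiff_quadform (R : idomainType) (p0 p1 p2 q0 q1 q2 : R) :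
  quadform p0 p1 p2 \is 2.-homog -> quadform q0 q1 q2 \is 2.-homog ->
  homdiff (quadform p0 p1 p2) (quadform q0 q1 q2) =
  quadform (p0 * q1 - p1 * q0) (2 * (p0 * q2 - p2 * q0)) (p1 * q2 - p2 * q1).
Proof.
move=> hp hq.
have Y0 : (varY : {mpoly R[2]}) != 0.
  apply/eqP => /(congr1 (fun p => eval2 p (0, 1))).
  rewrite eval2_varY /eval2 meval0 /= => /eqP; by rewrite oner_eq0.
apply: (mulfI Y0); rewrite (homdiffE hp hq).
have dX : (varX : {mpoly R[2]})^`M(ord0) = 1.
  rewrite /varX mderivX mnm1E eqxx /= scale1r.
  by rewrite -[X in (X - _)%MM]add0m addmK mpolyX0.
have dY : (varY : {mpoly R[2]})^`M(ord0) = 0.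
  by rewrite /varY mderivX mnm1E scale0r.
rewrite /quadform !expr2 !(mderivD, mderivZ, mderivM) dX dY -!mul_mpolyC.
rewrite !(mpolyCB, mpolyCM, mpolyCMn, mpolyC1); ring.
Qed.

(** * Common factors, common zeros and the resultant *)

Lemma dhomog1_nonunit (R : idomainType) (p : {mpoly R[2]}) :
  p \is 1.-homog -> p \isn't a GRing.unit.
Proof.
move=> /dhomogP hp; apply/negP; rewrite unfold_in => /andP[_ u].
have : p@_0 != 0 by apply: contraTneq u => ->; rewrite unitr0.
by rewrite mcoeff_eq0 negbK => /hp /=; rewrite mdeg0.
Qed.

Lemma linform_homog (R : comNzRingType) (v : R * R) : linform v \is 1.-homog.
Proof.
by rewrite /linform; apply: rpredB; apply: dhomogZ; rewrite dhomogX /= mdeg1.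
Qed.

Lemma prod_linform_homog (R : comNzRingType) (k : nat) (e : 'I_k -> R * R) :
  \prod_(i < k) linform (e i) \is k.-homog.
Proof.
elim: k e => [|k IH] e; first by rewrite big_ord0 dhomog1.
by rewrite big_ord_recl; apply: (dhomogM (linform_homog _)).
Qed.

(** When B^2 = AC, the form D = A X^2 + 2B XY + C Y^2 satisfies A D = (A X + B Y)^2 and C D = (B X +
    C Y)^2. The second hypothesis is apolarity to D, which makes the form vanish at the double root
    of D. The linear factor on the right does not depend on the p_i, so all forms apolar to D share
    it. *)
Lemma quadform_common_factor (K : fieldType) (p0 p1 p2 A B C : K) :
  B ^+ 2 - A * C = 0 -> p0 * C - p1 * B + p2 * A = 0 ->
  (A != 0 -> quadform p0 p1 p2 =
     linform (p0 * B / A ^+ 2 - p1 / A, p0 / A) * linform (- B, A)) /\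
  (C != 0 -> quadform p0 p1 p2 =
     linform (- p2 / C, p1 / C - p2 * B / C ^+ 2) * linform (- C, B)).
Proof.
move=> R0 apo; split=> n0.
- have p2E : p2 = (p1 * B - p0 * C) / A.
    apply: (mulIf n0); rewrite divfK //; apply/eqP.
    by rewrite -subr_eq0 -apo; apply/eqP; ring.
  have CE : C = B ^+ 2 / A.
    apply: (mulIf n0); rewrite divfK //; apply/eqP.
    by rewrite eq_sym -subr_eq0 (mulrC C) R0.
  rewrite p2E CE /quadform /linform /= -!mul_mpolyC.
  have e1 : p1 = p0 / A * B - (p0 * B / A ^+ 2 - p1 / A) * A by field.
  have e0 : p0 = p0 / A * A by field.
  have e2 : (p1 * B - p0 * (B ^+ 2 / A)) / A =
            - (p0 * B / A ^+ 2 - p1 / A) * B by field.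
  rewrite e2 [X in X%:MP * varX ^+ 2]e0 {1}e1.
  move: (p0 / A) (_ - p1 / A) => u v.
  rewrite !(mpolyCB, mpolyCD, mpolyCM, mpolyCN); ring.
- have p0E : p0 = (p1 * B - p2 * A) / C.
    apply: (mulIf n0); rewrite divfK //; apply/eqP.
    by rewrite -subr_eq0 -apo; apply/eqP; ring.
  have AE : A = B ^+ 2 / C.
    apply: (mulIf n0); rewrite divfK //; apply/eqP.
    by rewrite eq_sym -subr_eq0 R0.
  rewrite p0E AE /quadform /linform /= -!mul_mpolyC.
  have e2 : p2 = - (- p2 / C) * C by field.
  have e1 : p1 = (p1 / C - p2 * B / C ^+ 2) * C - (- p2 / C) * B by field.
  have e0 : (p1 * B - p2 * (B ^+ 2 / C)) / C =
            (p1 / C - p2 * B / C ^+ 2) * B by field.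
  rewrite e0 [X in X%:MP * varY ^+ 2]e2 {2}e1.
  move: (- p2 / C) (p1 / C - _) => u v.
  rewrite !(mpolyCB, mpolyCD, mpolyCM, mpolyCN); ring.
Qed.

Lemma relprime_minors_neq0 (K : fieldType) (p0 p1 p2 q0 q1 q2 : K) :
  let A := p0 * q1 - p1 * q0 in
  let B := p0 * q2 - p2 * q0 in
  let C := p1 * q2 - p2 * q1 in
  relprime (quadform p0 p1 p2) (quadform q0 q1 q2) ->
  (A != 0) || (C != 0) -> B ^+ 2 - A * C != 0.
Proof.
move=> A B C co AC; apply/eqP => R0.
(* These are 3x3 determinants of coefficient rows with a repeated row. *)
have ap : p0 * C - p1 * B + p2 * A = 0 by rewrite /A /B /C; ring.
have aq : q0 * C - q1 * B + q2 * A = 0 by rewrite /A /B /C; ring.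
have [pA pC] := quadform_common_factor R0 ap.
have [qA qC] := quadform_common_factor R0 aq.
case/orP: AC => n0.
- exact: (negP (dhomog1_nonunit (linform_homog _)) (co _ _ _ (pA n0) (qA n0))).
- exact: (negP (dhomog1_nonunit (linform_homog _)) (co _ _ _ (pC n0) (qC n0))).
Qed.

(** Elimination: r X^3 and r Y^3 are combinations of the two forms with explicit linear
    cofactors. *)
Lemma qval_pair_eq0 (L : fieldType) (p0 p1 p2 q0 q1 q2 : L) (v : L * L) :
  (p0 * q2 - p2 * q0) ^+ 2 - (p0 * q1 - p1 * q0) * (p1 * q2 - p2 * q1) != 0 ->
  (qval p0 p1 p2 v, qval q0 q1 q2 v) = (0, 0) -> v = (0, 0).
Proof.
case: v => x y; set r := (X in X != 0) => r0 [].
rewrite /qval /= => hp hq.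
have rx : r * x ^+ 3 = 0.
  transitivity ((p0 * x ^+ 2 + p1 * (x * y) + p2 * y ^+ 2) *
      (((p0 * q2 - p2 * q0) * q2 - (p1 * q2 - p2 * q1) * q1) * x
       - (p1 * q2 - p2 * q1) * q2 * y) -
    (q0 * x ^+ 2 + q1 * (x * y) + q2 * y ^+ 2) *
      (((p0 * q2 - p2 * q0) * p2 - (p1 * q2 - p2 * q1) * p1) * x
       - (p1 * q2 - p2 * q1) * p2 * y)); last by rewrite hp hq !mul0r subrr.
  rewrite /r; ring.
have ry : r * y ^+ 3 = 0.
  transitivity (- (p0 * x ^+ 2 + p1 * (x * y) + p2 * y ^+ 2) *
      (((p0 * q2 - p2 * q0) * q0 - (p0 * q1 - p1 * q0) * q1) * y
       - (p0 * q1 - p1 * q0) * q0 * x) +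
    (q0 * x ^+ 2 + q1 * (x * y) + q2 * y ^+ 2) *
      (((p0 * q2 - p2 * q0) * p0 - (p0 * q1 - p1 * q0) * p1) * y
       - (p0 * q1 - p1 * q0) * p0 * x)); last by rewrite hp hq oppr0 !mul0r addr0.
  rewrite /r; ring.
move/eqP: rx; rewrite mulf_eq0 (negPf r0) expf_eq0 /= => /eqP ->.
by move/eqP: ry; rewrite mulf_eq0 (negPf r0) expf_eq0 /= => /eqP ->.
Qed.

Lemma wedge_proj_eq (L : fieldType) (x y : L * L) :
  proj_eq x y -> wedge x y = 0.
Proof. by case: x y => [a b] [c d] [k [_ [-> ->]]]; rewrite /wedge /=; ring. Qed.

Lemma proj_eq_wedge (L : fieldType) (x y : L * L) :
  x != (0, 0) -> y != (0, 0) -> wedge x y = 0 -> proj_eq x y.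
Proof.
case: x y => [a b] [c d] x0 y0 /eqP; rewrite /wedge /= subr_eq0 => /eqP w.
have [a0|a0] := eqVneq a 0.
  have b0 : b != 0 by apply: contraNneq x0 => ->; rewrite a0.
  have c0 : c = 0.
    by apply/eqP; move/eqP: w; rewrite a0 mul0r eq_sym mulf_eq0 (negPf b0).
  have d0 : d != 0 by apply: contraNneq y0 => ->; rewrite c0.
  exists (d / b); rewrite mulf_neq0 ?invr_eq0 //; split=> //=.
  by rewrite a0 c0 mulr0 divfK.
have dE : d = b * c / a by apply: (mulIf a0); rewrite divfK // mulrC.
have c0 : c != 0 by apply: contraNneq y0 => c0; rewrite dE c0 mulr0 mul0r.
exists (c / a); rewrite mulf_neq0 ?invr_eq0 //; split=> //=.
by rewrite divfK // dE; congr pair; ring.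
Qed.

(** A nonzero right-hand side forces both forms to be nonzero, so uniqueness of the degree leaves
    exactly two linear factors on each side. Expressing the coefficients through the factors then
    gives the formula. *)
Lemma is_resultant_quadform (R : fieldType) (p0 p1 p2 q0 q1 q2 r : R) :
  quadform p0 p1 p2 \is 2.-homog -> quadform q0 q1 q2 \is 2.-homog ->
  (p0 * q2 - p2 * q0) ^+ 2 - (p0 * q1 - p1 * q0) * (p1 * q2 - p2 * q1) != 0 ->
  is_resultant (quadform p0 p1 p2) (quadform q0 q1 q2) r ->
  r = (p0 * q2 - p2 * q0) ^+ 2 - (p0 * q1 - p1 * q0) * (p1 * q2 - p2 * q1).
Proof.
move=> hp hq r_neq0 [m [n [ab [cd [_ _ pE qE ->]]]]].
have p_neq0 : quadform p0 p1 p2 != 0.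
  by apply: contraNneq r_neq0 => /quadform_eq0[-> -> ->]; apply/eqP; ring.
have q_neq0 : quadform q0 q1 q2 != 0.
  by apply: contraNneq r_neq0 => /quadform_eq0[-> -> ->]; apply/eqP; ring.
have two k (e : 'I_k -> R * R) p : p \is 2.-homog -> p != 0 ->
    p = \prod_(i < k) linform (e i) -> k = 2%N.
  move=> h pn0 pe; apply: (dhomog_uniq pn0 _ h).
  by rewrite pe prod_linform_homog.
move: (two _ _ _ hp p_neq0 pE) (two _ _ _ hq q_neq0 qE) => m2 n2; subst m n.
rewrite !big_ord_recl !big_ord0 !mulr1 in pE qE *.
have [-> -> ->] := quadform_linform2 pE.
have [-> -> ->] := quadform_linform2 qE.
ring.
Qed.

(* The quadratic form linform x * linform y is defined over K. *)
Definition sym_rational (K L : fieldType) (f : {rmorphism K -> L})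
    (x y : L * L) : Prop :=
  exists a b c : K, [/\ x.1 * y.1 = f a, x.1 * y.2 + x.2 * y.1 = f b
    & x.2 * y.2 = f c].

(** * Symmetric expressions and polar identities *)

Lemma sym_rational_qval (K L : fieldType) (f : {rmorphism K -> L})
    (p0 p1 p2 q0 q1 q2 : K) (x y : L * L) :
  sym_rational f x y ->
  sym_rational f
    (qval (f p0) (f p1) (f p2) x, qval (f q0) (f q1) (f q2) x)
    (qval (f p0) (f p1) (f p2) y, qval (f q0) (f q1) (f q2) y).
Proof.
case: x y => [x1 x2] [y1 y2] [a [b [c /= [ha hb hc]]]].
(* The required expressions are symmetric in x and y, hence polynomials in a, b, c; here b^2 - 2ac
   stands for x1^2 y2^2 + x2^2 y1^2. [M] gives p(x) p(y) and [N] gives p(x) q(y) + q(x) p(y). *)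
pose N (p0 p1 p2 q0 q1 q2 : K) : K :=
  2 * p0 * q0 * a ^+ 2 + (p0 * q1 + p1 * q0) * a * b
  + (p0 * q2 + p2 * q0) * (b ^+ 2 - 2 * a * c) + 2 * p1 * q1 * a * c
  + (p1 * q2 + p2 * q1) * b * c + 2 * p2 * q2 * c ^+ 2.
pose M (p0 p1 p2 : K) : K :=
  p0 ^+ 2 * a ^+ 2 + p0 * p1 * a * b + p0 * p2 * (b ^+ 2 - 2 * a * c)
  + p1 ^+ 2 * a * c + p1 * p2 * b * c + p2 ^+ 2 * c ^+ 2.
exists (M p0 p1 p2), (N p0 p1 p2 q0 q1 q2), (M q0 q1 q2).
rewrite /M /N /qval /=.
rewrite !(rmorphB, rmorphD, rmorphM, rmorphXn, rmorph_nat) -ha -hb -hc.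
split; ring.
Qed.

(** By Cauchy-Binet the left side pairs the minors of the coefficients with those of the monomials
    X^2, XY, Y^2 at x and y, each of which is divisible by [wedge x y]. *)
Lemma wedge_qval (R : comNzRingType) (p0 p1 p2 q0 q1 q2 : R) (x y : R * R) :
  wedge (qval p0 p1 p2 x, qval q0 q1 q2 x) (qval p0 p1 p2 y, qval q0 q1 q2 y) =
  wedge x y * ((p0 * q1 - p1 * q0) * (x.1 * y.1)
    + (p0 * q2 - p2 * q0) * (x.1 * y.2 + x.2 * y.1)
    + (p1 * q2 - p2 * q1) * (x.2 * y.2)).
Proof. rewrite /wedge /qval /=; ring. Qed.

(** The Gram determinant of the polar form on x, y is its determinant h0 h2 - h1^2/4 times the
    square of [wedge x y]. *)
Lemma sqr_qval_wedge (L : fieldType) (h0 h1 h2 : L) (x y : L * L) :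
  (2 : L) != 0 -> wedge x y = 0 ->
  qval h0 h1 h2 x * qval h0 h1 h2 y =
  (h0 * (x.1 * y.1) + h1 / 2 * (x.1 * y.2 + x.2 * y.1)
    + h2 * (x.2 * y.2)) ^+ 2.
Proof.
move=> n2 w; have n4 : (4 : L) != 0 by rewrite (natrM _ 2 2) mulf_neq0.
apply/eqP; rewrite -subr_eq0; apply/eqP.
transitivity (wedge x y ^+ 2 * (h0 * h2 - h1 ^+ 2 / 2 ^+ 2)); last first.
  by rewrite w expr0n mul0r.
by rewrite /wedge /qval; field; rewrite ?n4 ?n2.
Qed.

(* The right-hand side is the square of the polar form of a quarter of the
   Jacobian of (h0 X^2 + h1 XY + h2 Y^2, A X^2 + 2B XY + C Y^2); the cofactors
   in the proof come from linear algebra on the coefficients. *)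
Lemma sqr_qval_polar (L : fieldType) (h0 h1 h2 A B C : L) (x y : L * L) :
  (2 : L) != 0 ->
  h0 * C - h1 * B + h2 * A = 0 ->
  A * (x.1 * y.1) + B * (x.1 * y.2 + x.2 * y.1) + C * (x.2 * y.2) = 0 ->
  (B ^+ 2 - A * C) * (qval h0 h1 h2 x * qval h0 h1 h2 y) =
  ((h0 * B - h1 * A / 2) * (x.1 * y.1)
   + (h0 * C - h2 * A) / 2 * (x.1 * y.2 + x.2 * y.1)
   + (h1 * C / 2 - h2 * B) * (x.2 * y.2)) ^+ 2.
Proof.
case: x y => [x1 x2] [y1 y2]; rewrite /qval /= => n2 apo pol.
apply/eqP; rewrite -subr_eq0; apply/eqP.
have n4 : (4 : L) != 0 by rewrite (natrM _ 2 2) mulf_neq0.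
pose a := x1 * y1; pose b := x1 * y2 + x2 * y1; pose c := x2 * y2.
pose E := - 2 * h0 * h1 * C * b + 4 * h0 * h2 * A * a + 4 * h0 * h2 * B * b
  - h1 ^+ 2 * A * a + h1 ^+ 2 * B * b - h1 ^+ 2 * C * c
  - 2 * h1 * h2 * A * b + 4 * h1 * h2 * B * c - 4 * h2 ^+ 2 * A * c.
pose F := - 4 * h0 * A * a ^+ 2 - 4 * h0 * B * a * b + 4 * h2 * A * a * c
  - 4 * h1 * B * a * c - h2 * A * b ^+ 2 + h1 * B * b ^+ 2 - h0 * C * b ^+ 2.
transitivity (((A * a + B * b + C * c) * E
               + (h0 * C - h1 * B + h2 * A) * F) / 2 ^+ 2).
  by rewrite /E /F /a /b /c; field; rewrite ?n4 ?n2.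
by rewrite /a /b /c pol apo !mul0r addr0 mul0r.
Qed.

Lemma polar_sym_rational (K L : fieldType) (f : {rmorphism K -> L})
    (g0 g1 g2 : K) (x y : L * L) :
  sym_rational f x y ->
  exists z : K, f g0 * (x.1 * y.1) + f g1 * (x.1 * y.2 + x.2 * y.1)
    + f g2 * (x.2 * y.2) = f z.
Proof.
move=> [a [b [c [-> -> ->]]]]; exists (g0 * a + g1 * b + g2 * c).
by rewrite !rmorphD !rmorphM.
Qed.

(** * Iterates of the quadratic map on coordinates over the larger field *)

Section QuadraticMap.
Variables (K L : fieldType) (iota : {rmorphism K -> L}).
Variables p0 p1 p2 q0 q1 q2 : K.
Let P := quadform p0 p1 p2.
Let Q := quadform q0 q1 q2.

Lemma Fpoint0 v : Fpoint iota P Q 0 v = v.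
Proof. by case: v => a b; rewrite /Fpoint /= map_varX map_varY !eval2E. Qed.

Lemma FpointS n v :
  Fpoint iota P Q n.+1 v =
  (qval (iota p0) (iota p1) (iota p2) (Fpoint iota P Q n v),
   qval (iota q0) (iota q1) (iota q2) (Fpoint iota P Q n v)).
Proof.
rewrite /Fpoint /Fiter iterS -/(Fiter P Q n).
case: (Fiter P Q n) => f g; rewrite /P /Q /= !comp_quadform.
rewrite !rmorphD /= !map_mpolyZ !rmorphXn !rmorphM /= !expr2 !eval2E.
by rewrite /qval /= !expr2.
Qed.

(** Only the last application of F is absorbed into the form G = t0 P - s0 Q; hence the shift
    between the index of H and that of the iterate. *)
Lemma eval2_HpolyS s0 t0 n v :
  eval2 (map_mpoly iota (Hpoly P Q s0 t0 n.+1)) v =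
  qval (iota (t0 * p0 - s0 * q0)) (iota (t0 * p1 - s0 * q1))
       (iota (t0 * p2 - s0 * q2)) (Fpoint iota P Q n v).
Proof.
have -> : eval2 (map_mpoly iota (Hpoly P Q s0 t0 n.+1)) v =
    iota t0 * (Fpoint iota P Q n.+1 v).1 - iota s0 * (Fpoint iota P Q n.+1 v).2.
  by rewrite /Hpoly rmorphB /= !map_mpolyZ !eval2E.
rewrite FpointS /qval /= !rmorphB !rmorphM; ring.
Qed.

Lemma sym_rational_Fpoint n x y :
  sym_rational iota x y ->
  sym_rational iota (Fpoint iota P Q n x) (Fpoint iota P Q n y).
Proof.
move=> xy; elim: n => [|n IH]; first by rewrite !Fpoint0.
by rewrite !FpointS; apply: sym_rational_qval.
Qed.

(** Ensures that iterates represent points of the projective line, so that a vanishing wedge yields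
    [proj_eq]. *)
Lemma Fpoint_neq0 n v :
  (p0 * q2 - p2 * q0) ^+ 2 - (p0 * q1 - p1 * q0) * (p1 * q2 - p2 * q1) != 0 ->
  v != (0, 0) -> Fpoint iota P Q n v != (0, 0).
Proof.
rewrite -(fmorph_eq0 iota) !(rmorphB, rmorphM, rmorphXn) => r0 v0.
elim: n => [|n IH]; first by rewrite Fpoint0.
by rewrite FpointS; apply: contra_neq IH => /(qval_pair_eq0 r0).
Qed.

Lemma wedge_Fpoint n m x y :
  wedge (Fpoint iota P Q n x) (Fpoint iota P Q n y) = 0 ->
  (n <= m)%N -> wedge (Fpoint iota P Q m x) (Fpoint iota P Q m y) = 0.
Proof.
move=> w /subnK <-; elim: (m - n)%N => // k IH.
by rewrite addSn !FpointS wedge_qval IH mul0r.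
Qed.

End QuadraticMap.

Theorem theorem3p6 (K : fieldType) (char_neq2 : 2%N \notin [pchar K])
    (L : closedFieldType) (iota : {rmorphism K -> L})
    (Lclosure : algebraic_closure_of iota)
    (P Q : {mpoly K[2]})
    (homP : P \is 2.-homog) (homQ : Q \is 2.-homog) (coPQ : relprime P Q)
    (c : K) (c_neq0 : c != 0)
    (eta1 theta1 eta2 theta2 : L)
    (pt1 : (eta1, theta1) != (0, 0)) (pt2 : (eta2, theta2) != (0, 0))
    (factD : map_mpoly iota (homdiff P Q) =
       iota c *: ((theta1 *: varX - eta1 *: varY) *
                  (theta2 *: varX - eta2 *: varY)))
    (s0 t0 : K) (st_neq0 : (s0, t0) != (0, 0))
    (ell : nat) (ell_ge1 : (1 <= ell)%N)
    (coll : proj_eq (Fpoint iota P Q ell (eta1, theta1))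
                    (Fpoint iota P Q ell (eta2, theta2)))
    (ncoll : ~ proj_eq (Fpoint iota P Q ell.-1 (eta1, theta1))
                       (Fpoint iota P Q ell.-1 (eta2, theta2))) :
  let H n := eval2 (map_mpoly iota (Hpoly P Q s0 t0 n)) in
  [/\ (2 <= ell)%N,
      forall res : L,
        is_resultant (map_mpoly iota P) (map_mpoly iota Q) res ->
        in_squares iota (res * (H ell (eta1, theta1) * H ell (eta2, theta2)))
    & forall n : nat, (ell.+1 <= n)%N ->
        in_squares iota (H n (eta1, theta1) * H n (eta2, theta2))].
Proof.
have [p0 [p1 [p2 PE]]] := dhomog2_quadform homP.
have [q0 [q1 [q2 QE]]] := dhomog2_quadform homQ.
subst P Q; move=> H; rewrite (homdiff_quadform homP homQ) map_quadform in factD.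
set A := p0 * q1 - p1 * q0 in factD *; set B := p0 * q2 - p2 * q0 in factD *.
set C := p1 * q2 - p2 * q1 in factD *.
have n2 : (2 : K) != 0 by move: char_neq2; rewrite inE /=.
have n2L : (2 : L) != 0 by rewrite -(rmorph_nat iota) fmorph_eq0.
have cL0 : iota c != 0 by rewrite fmorph_eq0.
have [AE BE CE] : [/\ iota A = iota c * (theta1 * theta2),
    iota (2 * B) = - iota c * (eta1 * theta2 + theta1 * eta2)
    & iota C = iota c * (eta1 * eta2)].
  by apply: qval_inj => v; rewrite -eval2_quadform factD !eval2E /qval; ring.
rewrite rmorphM rmorph_nat in BE.
set v1 := (eta1, theta1) in pt1 coll ncoll *.
set v2 := (eta2, theta2) in pt2 coll ncoll *.
(* The critical points need not have coordinates in K, but these symmetric expressions are, up to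
   sign, the coefficients of D/c. *)
have sym : sym_rational iota v1 v2.
  exists (C / c), (- (2 * B) / c), (A / c) => /=.
  rewrite !(fmorph_div, rmorphN, rmorphM, rmorph_nat) AE CE BE /=.
  by split; field.
(* If A, B and C all vanished, then theta1 theta2, eta1 eta2 and eta1 theta2 + theta1 eta2 would be
   zero, forcing one of the two coordinate pairs to be (0,0). *)
have D_neq0 : (A != 0) || (C != 0) || (B != 0).
  rewrite -!(fmorph_eq0 iota); apply/negPn; rewrite !negb_or !negbK.
  apply/negP => /andP[/andP[/eqP A0 /eqP C0] /eqP B0].
  move: AE CE BE; rewrite A0 C0 B0 mulr0.
  move=> /esym/eqP; rewrite mulf_eq0 (negPf cL0) mulf_eq0 /= => tt.
  move=> /esym/eqP; rewrite mulf_eq0 (negPf cL0) mulf_eq0 /= => ee.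
  move=> /esym/eqP; rewrite mulf_eq0 oppr_eq0 (negPf cL0) /=.
  move: pt1 pt2; rewrite /v1 /v2 !xpair_eqE !negb_and.
  case/orP: tt => /eqP ->; case/orP: ee => /eqP ->;
    rewrite ?eqxx ?mulr0 ?mul0r ?addr0 ?add0r ?orbF //= => a b;
    by rewrite mulf_eq0 ?(negPf a) ?(negPf b).
have R0 : B ^+ 2 - A * C != 0.
  have [AC0|] := boolP ((A != 0) || (C != 0)).
    exact: relprime_minors_neq0.
  rewrite negb_or !negbK => /andP[/eqP A0 /eqP C0].
  by move: D_neq0; rewrite A0 C0 eqxx mul0r subr0 expf_eq0.
have w0 n v w : v != (0, 0) -> w != (0, 0) ->
    ~ proj_eq (Fpoint iota (quadform p0 p1 p2) (quadform q0 q1 q2) n v)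
              (Fpoint iota (quadform p0 p1 p2) (quadform q0 q1 q2) n w) ->
    wedge (Fpoint iota (quadform p0 p1 p2) (quadform q0 q1 q2) n v)
          (Fpoint iota (quadform p0 p1 p2) (quadform q0 q1 q2) n w) != 0.
  move=> v0 w0; apply: contra_not_neq => /proj_eq_wedge; apply;
    exact: Fpoint_neq0.
case: ell ell_ge1 coll ncoll => // l _ /wedge_proj_eq coll /(w0 _ _ _ pt1 pt2).
move=> /= ncoll.
(* Now ell = l + 1. The wedge of the l-th iterates is nonzero and cancels, leaving D(x, y) = 0 for x
   = F^l(v1), y = F^l(v2). *)
have pol := coll; move: pol; rewrite !FpointS wedge_qval => /eqP.
rewrite mulf_eq0 (negPf ncoll) orFb => /eqP.
rewrite -!rmorphM -!rmorphB -/A -/B -/C => pol.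
split.
(* For l = 0 the points are v1 and v2 themselves, and -2 D(v1, v2) = c (v1 ^ v2)^2. *)
- case: l pol ncoll {coll} => // pol; rewrite !Fpoint0 /= => w; exfalso.
  move: pol; rewrite !Fpoint0 /= AE CE => pol.
  have : iota c * wedge v1 v2 ^+ 2 = 0.
    transitivity (- 2 * (iota c * (theta1 * theta2) * (eta1 * eta2)
      + iota B * (eta1 * theta2 + theta1 * eta2)
      + iota c * (eta1 * eta2) * (theta1 * theta2))); last by rewrite pol mulr0.
    have -> : iota B = - iota c * (eta1 * theta2 + theta1 * eta2) / 2.
      by rewrite -BE mulrC mulKf.
    by rewrite /wedge /=; field.
  by apply/eqP; rewrite mulf_neq0 // expf_neq0.
- move=> res hres.
  have hom (p : {mpoly K[2]}) :
      p \is 2.-homog -> map_mpoly iota p \is 2.-homog.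
    move=> /dhomogP hp; apply/dhomogP => m.
    by rewrite mcoeff_msupp mcoeff_map_mpoly fmorph_eq0 -mcoeff_msupp => /hp.
  have resE : res = iota (B ^+ 2 - A * C).
    rewrite !map_quadform in hres; rewrite (is_resultant_quadform _ _ _ hres).
    + by rewrite /A /B /C !(rmorphB, rmorphM, rmorphXn).
    + by rewrite -map_quadform; apply: hom.
    + by rewrite -map_quadform; apply: hom.
    + by rewrite -!(rmorphM, rmorphB, rmorphXn) fmorph_eq0.
  rewrite resE /H !eval2_HpolyS !(rmorphB _ (B ^+ 2)) rmorphXn rmorphM /=.
  (* The side condition is apolarity of G to D, inherited by linearity from P and Q. *)
  rewrite (sqr_qval_polar n2L _ pol); last first.
    by rewrite -!rmorphM -!rmorphB -rmorphD; apply/eqP;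
      rewrite fmorph_eq0; apply/eqP; rewrite /A /B /C; ring.
  set h0 := t0 * p0 - _; set h1 := t0 * p1 - _; set h2 := t0 * p2 - _.
  have [z zE] := polar_sym_rational (h0 * B - h1 * A / 2)
    ((h0 * C - h2 * A) / 2) (h1 * C / 2 - h2 * B)
    (sym_rational_Fpoint p0 p1 p2 q0 q1 q2 l sym).
  exists z; rewrite rmorphXn -zE; congr (_ ^+ 2).
  by rewrite !(rmorphB, rmorphM, fmorphV, rmorph_nat).
(* With index n + 1 > l + 1, the iterates entering G have index n >= l + 1, where the wedge already
   vanishes. *)
- case=> // n; rewrite ltnS => /(wedge_Fpoint coll) w.
  rewrite /H !eval2_HpolyS (sqr_qval_wedge _ _ _ n2L w).
  set h0 := t0 * p0 - _; set h1 := t0 * p1 - _; set h2 := t0 * p2 - _.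
  have [z zE] := polar_sym_rational h0 (h1 / 2) h2
    (sym_rational_Fpoint p0 p1 p2 q0 q1 q2 n sym).
  by exists z; rewrite rmorphXn -zE fmorph_div rmorph_nat.
Qed.
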